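(* For every $n\ge 1$, $$|E(\mathrm{Dom}_{T_n}(C_n))|=F_{2n-1},$$ where $F_m$ denotes the $m$-th Fibonacci number.
   Context: $X_n=\{1,2,\dots,n\}$ is the finite chain with its usual order, and $T_n$ is the full transformation semigroup of all maps $X_n\to X_n$, written on the right and composed left to right. The Catalan monoid $C_n$ is the subsemigroup of $T_n$ of all maps $\alpha$ that are both order-decreasing ($x\alpha\le x$ for all $x\in X_n$) and order-preserving ($x\le y\Rightarrow x\alpha\le y\alpha$ for all $x,y\in X_n$). For a subsemigroup $U$ of a semigroup $S$, an element $d\in S$ is dominated by $U$ if for every semigroup $T$ and all semigroup homomorphisms $f,g:S\to T$ with $f|_U=g|_U$ one has $(d)f=(d)g$; the dominion $\mathrm{Dom}_S(U)$ is the set of all elements of $S$ dominated by $U$ (a subsemigroup of $S$ containing $U$). $E(S)$ denotes the set of idempotents of a semigroup $S$. Fibonacci numbers: $F_1=F_2=1$ and $F_m=F_{m-1}+F_{m-2}$ for $m\ge 3$. *)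

(* Defs.v *)
From HB Require Import structures.
From mathcomp Require Import all_boot.
From mathcomp Require Import boolp classical_sets functions cardinality.

Set Implicit Arguments.
Unset Strict Implicit.
Unset Printing Implicit Defensive.

Local Open Scope classical_set_scope.
Local Open Scope group_scope.

(* A [semigroupType] also carries a [choiceType] structure.  Classically this *)
(* is no restriction on the test semigroup [T]: every type has such a         *)
(* structure (see [gen_eqMixin] and [gen_choiceMixin] in boolp).              *)
Definition dominated (S : semigroupType) (U : mulgClosed S) (d : S) : Prop :=
  forall (T : semigroupType) (f g : {multiplicative S -> T}),
    {in U, f =1 g} -> f d = g d.

Definition dominion (S : semigroupType) (U : mulgClosed S) : set S :=
  [set d | dominated U d].

Definition idempotents (S : semigroupType) (A : set S) : set S :=
  [set e | A e /\ e * e = e].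

(* The chain 1 < 2 < ... < n is represented by 'I_n, that is 0 < ... < n - 1. *)
Definition trans (n : nat) : predArgType := {ffun 'I_n -> 'I_n}.

HB.instance Definition _ n := Finite.on (trans n).

(* Maps act on the right: in [trans_mul a b], [a] is applied first. *)
Definition trans_mul n (a b : trans n) : trans n := [ffun x => b (a x)].

Lemma trans_mulA n : associative (@trans_mul n).
Proof. by move=> a b c; apply/ffunP => x; rewrite !ffunE. Qed.

HB.instance Definition _ n := isSemigroup.Build (trans n) (@trans_mulA n).

Definition order_decreasing n (a : trans n) : bool :=
  [forall x : 'I_n, (a x <= x)%N].

Definition order_preserving n (a : trans n) : bool :=
  [forall x : 'I_n, forall y : 'I_n, (x <= y)%N ==> (a x <= a y)%N].

Definition catalan n : {pred trans n} :=
  [pred a | order_decreasing a && order_preserving a].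

Lemma catalan_mulg_closed n : mulg_closed (@catalan n).
Proof.
move=> a b /andP[/forallP da /forallP pa] /andP[/forallP db /forallP pb].
apply/andP; split; apply/forallP => x.
  by rewrite ffunE (leq_trans (db _)) ?da.
apply/forallP => y; apply/implyP => xy; rewrite !ffunE.
have /forallP/(_ (a y))/implyP := pb (a x); apply.
by have /forallP/(_ y)/implyP := pa x; apply.
Qed.

HB.instance Definition _ n :=
  isMulClosed.Build (trans n) (@catalan n) (@catalan_mulg_closed n).

Fixpoint fib (m : nat) : nat :=
  match m with
  | 0 => 0
  | 1 => 1
  | (k.+1 as l).+1 => fib l + fib k
  end.

(* Main.v *)
From HB Require Import structures.
Require Import Defs.
From mathcomp Require Import all_boot.
From mathcomp Require Import zify.
From mathcomp Require Import boolp classical_sets functions cardinality.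

Set Implicit Arguments.
Unset Strict Implicit.
Unset Printing Implicit Defensive.

(* An idempotent is dominated by C_n exactly when it is order-preserving and  *)
(* fixes the least point.  If d has an inner inverse u such that u, ud and du *)
(* lie in C_n, then d is dominated, and every order-preserving idempotent     *)
(* fixing 0 has one.  Conversely a dominated map commutes with every          *)
(* C_n-equivariant self-map of a T_n-act; the constant map 0 on the chain and *)
(* the sorting map (x, y) |-> (min x y, max x y) on pairs force the two       *)
(* properties.  Such an idempotent e is determined by the word recording      *)
(* whether each point is fixed, moved up or moved down; the words that occur  *)
(* start with a fixed letter, do not end with up, and have no up immediately  *)
(* followed by down, and a transfer recursion counts them by F_{2n-1}.        *)

Definition selfmap (P : Type) : Type := P -> P.

HB.instance Definition _ (P : Type) := gen_eqMixin (selfmap P).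
HB.instance Definition _ (P : Type) := gen_choiceMixin (selfmap P).

Lemma selfmap_compA (P : Type) :
  associative (fun a b : selfmap P => (a \o b : selfmap P)).
Proof. by []. Qed.

HB.instance Definition _ (P : Type) :=
  isSemigroup.Build (selfmap P) (@selfmap_compA P).

Section Domination.

Variables (S : semigroupType) (U : mulgClosed S).

Local Open Scope group_scope.

(** Zigzag: f(d) = f(d)g(ud) = f(d)f(u)g(d) = g(du)g(d) = g(d), passing between [f] and [g] at
    [u * d], [u] and [d * u]. *)
Lemma dominated_inner_inverse (d u : S) :
  u \in U -> u * d \in U -> d * u \in U -> d * u * d = d -> dominated U d.
Proof.
move=> uU udU duU dud T f g fg.
have fM := @gmulfM _ _ f; have gM := @gmulfM _ _ g.
rewrite -[in LHS]dud -mulgA fM (fg _ udU) gM -(fg _ uU) mulgA -fM (fg _ duU) -gM.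
by rewrite dud.
Qed.

Section Act.

Variables (Z : Type) (act : Z -> S -> Z) (w : Z -> Z).
Hypothesis actM : forall z a b, act z (a * b) = act (act z a) b.

(** Pairs of vectors over the field with two elements, with coordinates indexed by [Z]. Pulling back
    along a right action gives a homomorphism into self-maps under composition. *)
Let P : Type := ((Z -> bool) * (Z -> bool))%type.

Definition pullback (a : S) : selfmap P :=
  fun p => (fun z => p.1 (act z a), fun z => p.2 (act z a)).

(* The conjugate of [pullback] by the involution (m, k) |-> (m, k + m o w). *)
Definition twisted_pullback (a : S) : selfmap P :=
  fun p => (fun z => p.1 (act z a),
            fun z => p.2 (act z a) (+) p.1 (w (act z a)) (+) p.1 (act (w z) a)).

Lemma pullbackM : {morph pullback : a b / a * b}.
Proof.
move=> a b; apply/funext => p; rewrite /pullback /=.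
by congr pair; apply/funext => z; rewrite actM.
Qed.

Lemma twisted_pullbackM : {morph twisted_pullback : a b / a * b}.
Proof.
move=> a b; apply/funext => p; rewrite /twisted_pullback /=.
congr pair; apply/funext => z /=; rewrite !actM //.
by rewrite -!addbA; congr (_ (+) (_ (+) _)); rewrite addKb.
Qed.

HB.instance Definition _ := isMultiplicative.Build _ _ pullback pullbackM.
HB.instance Definition _ :=
  isMultiplicative.Build _ _ twisted_pullback twisted_pullbackM.

(** [pullback] and its conjugate agree at an element exactly when [w] commutes with its action. This
    holds on [U], so domination carries it to [d]. *)
Lemma dominated_equivariant (d : S) :
    (forall u z, u \in U -> w (act z u) = act (w z) u) ->
  dominated U d -> forall z, w (act z d) = act (w z) d.
Proof.
move=> wU domd z.
have eqU : {in U, pullback =1 twisted_pullback}.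
  move=> u uU; apply/funext => p; rewrite /pullback /twisted_pullback.
  congr pair; apply/funext => y.
  by rewrite wU // -addbA addbb addbF.
(* Testing on the indicator of [act (w z) d]: the two correction terms must cancel at [z], and the
   second one is true. *)
have /(congr1 (fun h : selfmap P =>
  (h (fun y => `[< y = act (w z) d >], fun=> false)).2 z)) :=
  domd (selfmap P) pullback twisted_pullback eqU.
rewrite /= [X in _ (+) X]asboolT //.
by rewrite addbT => /esym/negbFE/asboolP.
Qed.

End Act.

End Domination.

(** * The idempotents of the dominion *)

Section MonotoneIdempotents.

Variable m : nat.

Implicit Types (a d e u : trans m.+1) (x y z : 'I_m.+1).

Lemma order_preservingP a :
  reflect {homo a : x y / x <= y} (order_preserving a).
Proof.
apply: (iffP forallP) => [am x y xy | am x].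
  by have /forallP/(_ y)/implyP/(_ xy) := am x.
by apply/forallP => y; apply/implyP/am.
Qed.

Lemma catalanP a :
  reflect ((forall x, a x <= x) /\ {homo a : x y / x <= y}) (a \in @catalan m.+1).
Proof.
apply: (iffP andP) => -[da am]; split; try exact/order_preservingP.
  exact/forallP.
exact/forallP.
Qed.

Lemma dominated_fix0 d : dominated (@catalan m.+1) d -> d ord0 = ord0.
Proof.
move=> domd; apply/esym.
apply: (dominated_equivariant (act := fun z (a : trans m.+1) => a z)
  (w := fun=> ord0) _ _ domd ord0) => [z a b | u z /catalanP[du _]].
  by rewrite ffunE.
by apply/esym/val_inj/eqP; rewrite -leqn0 du.
Qed.

Lemma dominated_order_preserving d :
  dominated (@catalan m.+1) d -> order_preserving d.
Proof.
move=> domd; apply/order_preservingP => x y xy.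
pose Z := ('I_m.+1 * 'I_m.+1)%type.
pose act (z : Z) (a : trans m.+1) : Z := (a z.1, a z.2).
pose w (z : Z) : Z := if z.1 <= z.2 then z else (z.2, z.1).
(* The pair is taken in the wrong order, so that sorting before [d] acts gives (d x, d y), which
   must then itself be sorted. *)
have: w (act (y, x) d) = act (w (y, x)) d.
  apply: (dominated_equivariant _ _ domd) => [z a b | u [s t] /catalanP[_ um]].
    by rewrite /act !ffunE.
  rewrite /w /act /=; case: (leqP s t) => [st | ts]; first by rewrite um.
  case: leqP => //= uts; congr pair; apply/val_inj/eqP; rewrite eqn_leq uts um //;
  exact: ltnW.
rewrite /w /act /=; case: (leqP y x) => [yx _ | _].
  by have /val_inj-> : val x = val y by apply/eqP; rewrite eqn_leq xy.
by case: leqP => [yx [yx'] | /ltnW //]; rewrite yx'.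
Qed.

Definition monotone_idem0 : {pred trans m.+1} :=
  [pred e | [&& order_preserving e, e ord0 == ord0 & [forall x, e (e x) == e x]]].

Lemma monotone_idem0P e :
  reflect [/\ {homo e : x y / x <= y}, e ord0 = ord0 & forall x, e (e x) = e x]
          (e \in monotone_idem0).
Proof.
apply: (iffP and3P) => -[em e0 ee]; split.
- exact/order_preservingP.
- exact/eqP.
- by move=> x; apply/eqP; have /forallP := ee.
- exact/order_preservingP.
- exact/eqP.
- by apply/forallP => x; apply/eqP.
Qed.

(* The inner inverse u sends x to the least point of the block of the largest *)
(* image point below x.                                                       *)
Lemma monotone_idem0_dominated e :
  e \in monotone_idem0 -> dominated (@catalan m.+1) e.
Proof.
case/monotone_idem0P=> em e0 ee.
pose low x : 'I_m.+1 := [arg min_(z < x | e z == e x) z].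
have lowP x : e (low x) = e x /\ forall z, e z = e x -> low x <= z.
  rewrite /low; case: arg_minnP => // z /eqP ez zmin; split=> // t /eqP; exact: zmin.
pose fl x : 'I_m.+1 := [arg max_(z > ord0 | (e z == z) && (z <= x)) z].
have flP x : [/\ e (fl x) = fl x, fl x <= x &
    forall z, e z = z -> z <= x -> z <= fl x].
  rewrite /fl; case: arg_maxnP => [|z /andP[/eqP ez zx] zmax]; first by rewrite e0 eqxx.
  by split=> // t et tx; apply: zmax; rewrite et eqxx.
have lowm x y : e x <= e y -> low x <= low y.
  move=> exy; have [elx lx] := lowP x; have [ely ly] := lowP y.
  rewrite leqNgt; apply/negP => lyx; move: (lyx); rewrite ltnNge => /negP[].
  apply: lx; apply/val_inj/eqP; rewrite /= eqn_leq ely exy andbT -elx -ely.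
  by rewrite em // ltnW.
have flm x y : x <= y -> fl x <= fl y.
  have [efx fx _] := flP x; have [_ _ fy] := flP y.
  by move=> xy; apply: fy => //; apply: leq_trans xy.
have lowl x : low x <= x by have [_] := lowP x; apply.
have fll x : fl x <= x by have [] := flP x.
have efl x : e (fl x) = fl x by have [] := flP x.
have elow x : e (low x) = e x by have [] := lowP x.
have fle x : fl (e x) = e x.
  have [_ _ fx] := flP (e x).
  by apply/val_inj/eqP; rewrite eqn_leq fll fx.
pose u : trans m.+1 := [ffun x => low (fl x)].
(* Here [u * e] is [fl], and [e * u] sends each point to the least point of its block. *)
apply: (@dominated_inner_inverse _ _ e u).
- apply/catalanP; split=> [x|x y xy]; rewrite !ffunE.
    exact: leq_trans (lowl _) (fll _).
  by apply: lowm; rewrite !efl flm.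
- apply/catalanP; split=> [x|x y xy]; rewrite !ffunE !elow !efl //.
  exact: flm.
- apply/catalanP; split=> [x|x y xy]; rewrite !ffunE !fle.
    by have [_] := lowP (e x); apply; rewrite ee.
  by apply: lowm; rewrite !ee em.
- by apply/ffunP => x; rewrite !ffunE fle elow ee.
Qed.

Lemma idempotents_dominion_catalan :
  idempotents (dominion (@catalan m.+1)) = [set` monotone_idem0]%classic.
Proof.
apply/seteqP; split=> e /=.
  case=> domd /ffunP ee; apply/monotone_idem0P; split.
  - exact/order_preservingP/dominated_order_preserving.
  - exact: dominated_fix0.
  - by move=> x; have := ee x; rewrite ffunE.
move=> eE; split; first exact: monotone_idem0_dominated.
by have /monotone_idem0P[_ _ ee] := eE; apply/ffunP => x; rewrite ffunE.
Qed.

End MonotoneIdempotents.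

(** * Counting the admissible words *)

(* [None] marks a fixed point. *)
Definition letter := option bool.
Definition up : letter := Some true.
Definition down : letter := Some false.

Definition compatible (a b : letter) := (a != up) || (b != down).

(** The letter [a] stands just before [s]; keeping it as a parameter makes the count recursive. *)
Definition valid_word (a : letter) (s : seq letter) :=
  path compatible a s && (last a s != up).

Fixpoint all_words (k : nat) : seq (seq letter) :=
  if k is k'.+1 then
    [seq a :: s | a <- [:: None; up; down], s <- all_words k']
  else [:: [::]].

Definition words (k : nat) := [seq s <- all_words k | valid_word None s].

Lemma mem_all_words k s : (s \in all_words k) = (size s == k).
Proof.
elim: k s => [|k IHk] s; first by rewrite inE size_eq0.
apply/allpairsP/idP => [[[a t] [_ tk ->]]|]; first by rewrite eqSS -IHk.
case: s => // a s; rewrite eqSS -IHk => sk.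
by exists (a, s); split=> //; case: a => [[]|].
Qed.

Lemma uniq_all_words k : uniq (all_words k).
Proof.
elim: k => // k IHk; apply: (@allpairs_uniq _ _ _ cons [:: None; up; down]) => //.
by move=> [a s] [b t] _ _ /= [-> ->].
Qed.

(** Let U_k and N_k be the counts after [up] and after another letter. Only [down] is barred after
    [up], so U_{k+1} = N_k + U_k and N_{k+1} = 2 N_k + U_k, with U_0 = 0 and N_0 = 1. *)
Lemma count_valid_word k a :
  count (valid_word a) (all_words k) = fib (if a == up then 2 * k else (2 * k).+1).
Proof.
elim: k a => [|k IHk] a; first by case: a => [[]|].
have cnt b : count (preim (cons b) (valid_word a)) (all_words k) =
    compatible a b * fib (if b == up then 2 * k else (2 * k).+1).
  case ab: (compatible a b); last first.
    rewrite mul0n; apply/eqP; rewrite -leqn0 leqNgt -has_count.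
    by apply/hasPn => s _ /=; rewrite /valid_word /= ab.
  by rewrite mul1n -IHk; apply: eq_count => s; rewrite /valid_word /= ab.
rewrite /= !count_cat !count_map /= !cnt mulnS !add2n.
by case: a {cnt} => [[]|] /=; rewrite ?mul0n ?mul1n ?addn0; lia.
Qed.

Lemma size_words k : size (words k) = fib (2 * k).+1.
Proof. by rewrite size_filter count_valid_word. Qed.

(** A run of [up] cannot be followed by [down], so it can only end at [None]. *)
Lemma up_before_fixed (W : nat -> letter) m x y :
  (forall i, i < m -> compatible (W i) (W i.+1)) ->
  x < y <= m -> W x = up -> W y != up -> exists2 z, x < z <= y & W z = None.
Proof.
move=> Wc /andP[xy ym] Wx; elim: y xy ym => // y IHy xy ym Wy.
have [Wyu | Wyu] := eqVneq (W y) up.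
  exists y.+1; first by rewrite xy leqnn.
  have := Wc _ ym; rewrite /compatible Wyu eqxx /=.
  by case: (W y.+1) Wy => [[]|].
have xy' : x < y.
  by rewrite ltn_neqAle -ltnS xy andbT; apply: contra_neq Wyu => <-.
have [z /andP[xz zy] Wz] := IHy xy' (ltnW ym) Wyu.
by exists z; rewrite // xz leqW.
Qed.

(** * The bijection between idempotents and words *)

Section Coding.

Variable m : nat.

Implicit Types (e : trans m.+1) (x y z : 'I_m.+1).

Definition code e x : letter := if e x == x then None else Some (x < e x).

Lemma code_fix e x : code e x = None -> e x = x.
Proof. by rewrite /code; case: eqP. Qed.

Lemma code_up e x : (code e x == up) = (x < e x).
Proof.
rewrite /code; case: (e x =P x) => [->|_]; first by rewrite ltnn.
by rewrite /up; case: (x < e x).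
Qed.

Lemma code_down e x : (code e x == down) = (e x < x).
Proof.
rewrite /code; case: (e x =P x) => [->|exx]; first by rewrite ltnn.
by rewrite /down; case: ltngtP => // /val_inj/esym.
Qed.

(** Equal codes give equal fixed points, so each map fixes the image of the other. If both move [x]
    up, then e x <= e (e' x) = e' x, and symmetrically; moves down are dual. *)
Lemma code_inj e e' : e \in @monotone_idem0 m -> e' \in @monotone_idem0 m ->
  code e =1 code e' -> e = e'.
Proof.
move=> /monotone_idem0P[em _ ee] /monotone_idem0P[em' _ ee'] ce.
have fixe x : e x = x <-> e' x = x.
  split=> ex; apply: code_fix; [rewrite -ce | rewrite ce];
  by rewrite /code ex eqxx.
have efix x : e' (e x) = e x by apply/fixe.
have efix' x : e (e' x) = e' x by apply/fixe.
apply/ffunP => x; apply/val_inj/eqP => /=; rewrite eqn_leq.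
case cx: (code e x) (ce x) => [b|] cx'; last first.
  by rewrite (code_fix cx) (code_fix (esym cx')) leqnn.
case: b cx cx' => /eqP + /esym/eqP.
  rewrite !code_up => xe xe'; apply/andP; split.
    by rewrite -(efix' x) em // ltnW.
  by rewrite -(efix x) em' // ltnW.
rewrite !code_down => xe xe'; apply/andP; split.
  by rewrite -(efix x) em' // ltnW.
by rewrite -(efix' x) em // ltnW.
Qed.

(** If x < e x, then x + 1 <= e x <= e (x + 1). *)
Lemma code_compatible e x y : e \in @monotone_idem0 m -> y = x.+1 :> nat ->
  compatible (code e x) (code e y).
Proof.
case/monotone_idem0P=> em _ ee yx; rewrite /compatible code_up code_down.
rewrite -implybE -leqNgt; apply/implyP => xe.
have := em y (e x); rewrite ee yx => /(_ xe) eyx.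
by apply: leq_trans xe _; apply: em; rewrite yx.
Qed.

(** The map sends an [up] point to the next [None] above it and any other point to the nearest
    [None] at or below it. These exist by [up_before_fixed] and by [W 0 = None]. *)
Lemma code_surj (W : nat -> letter) :
    W 0 = None -> (forall i, i < m -> compatible (W i) (W i.+1)) -> W m != up ->
  exists2 e, e \in @monotone_idem0 m & forall x, code e x = W x.
Proof.
move=> W0 Wc Wm.
pose fl x : 'I_m.+1 := [arg max_(z > ord0 | (W z == None) && (z <= x)) z].
have flP x : [/\ W (fl x) = None, fl x <= x &
    forall z, W z = None -> z <= x -> z <= fl x].
  rewrite /fl; case: arg_maxnP => [|z /andP[/eqP Wz zx] zmax]; first by rewrite /= W0.
  by split=> // t Wt tx; apply: zmax; rewrite Wt eqxx.
(* The implication sits under the existential so that [choice] yields a total function [cl]. *)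
have clP x : exists y, W x = up -> [/\ W y = None, x < y &
    forall z, W z = None -> x <= z -> y <= z].
  have [Wx | /eqP Wx] := eqVneq (W x) up; last by exists x => /Wx.
  have xm : x < m.
    by rewrite ltn_neqAle -ltnS ltn_ord andbT; apply: contraNneq Wm => <-; rewrite Wx.
  have [|z /andP[xz zm] Wz] := up_before_fixed (x := x) (y := m) Wc _ Wx Wm.
    by rewrite xm /=.
  have zm1 : z < m.+1 by [].
  pose z0 := Ordinal zm1.
  have [y /andP[/eqP Wy xy] ymin] :=
    @arg_minnP _ z0 (fun t : 'I_m.+1 => (W t == None) && (x < t)) val
      (introT andP (conj (introT eqP Wz) xz)).
  exists y => _; split=> // t Wt xt; apply: ymin; rewrite Wt eqxx /=.
  rewrite ltn_neqAle xt andbT; apply/eqP => xt'.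
  by move: Wt; rewrite -xt' Wx.
have [cl {}clP] := choice clP.
pose e : trans m.+1 := [ffun x : 'I_m.+1 => if W x == up then cl x else fl x].
have eup (x : 'I_m.+1) : W x = up -> e x = cl x by move=> Wx; rewrite ffunE Wx.
have enup (x : 'I_m.+1) : W x != up -> e x = fl x by move=> /negPf Wx; rewrite ffunE Wx.
have efixed x : W (e x) = None.
  rewrite ffunE; case: eqP => [/clP[]|_] //; by have [] := flP x.
have fixede (x : 'I_m.+1) : W x = None -> e x = x.
  move=> Wx; rewrite enup ?Wx //; have [_ fx fmax] := flP x.
  by apply/val_inj/eqP; rewrite eqn_leq fx fmax.
exists e.
  apply/monotone_idem0P; split=> [x y|| x]; last 2 first.
  - exact: fixede.
  - exact: fixede.
  rewrite leq_eqVlt => /orP[/eqP/val_inj-> // | xy].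
  have [exy | yex] := leqP (e x) y.
    have [Wy | Wy] := eqVneq (W y) up.
      by rewrite (eup y) //; have [_ /ltnW ycl _] := clP _ Wy; apply: leq_trans ycl.
    by rewrite (enup y) //; have [_ _] := flP y; apply.
  (* Now [e x] jumps over [y], so no [None] lies above [x] and up to [y]; hence [y] is also [up],
     and [e y] is a [None] position above [x]. *)
  have Wx : W x = up.
    apply/eqP; apply: contraLR yex => /enup->; rewrite -leqNgt.
    by have [_ fx _] := flP x; apply: leq_trans fx (ltnW xy).
  have [_ _ clmin] := clP _ Wx.
  have [Wy | Wy] := eqVneq (W y) up.
    rewrite (eup x) //; apply: clmin; first exact: efixed.
    rewrite (eup y) //; have [_ ycl _] := clP _ Wy.
    exact: ltnW (ltn_trans xy ycl).
  have [|z /andP[xz zy] Wz] := up_before_fixed (x := x) (y := y) Wc _ Wx Wy.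
    by rewrite xy /= -ltnS.
  have zm : z < m.+1 by apply: leq_ltn_trans zy _.
  have := clmin (Ordinal zm) Wz (ltnW xz).
  by rewrite -(eup x) // => /leq_trans/(_ zy); rewrite leqNgt yex.
move=> x; case Wx: (W x) => [[]|].
- by apply/eqP; rewrite code_up eup //; have [] := clP _ Wx.
- apply/eqP; rewrite code_down enup ?Wx //; have [Wf fx _] := flP x.
  rewrite ltn_neqAle fx andbT; apply/eqP => /val_inj fxx.
  by move: Wf; rewrite fxx Wx.
- by rewrite /code fixede // eqxx.
Qed.

(* The letter at 0 is omitted: it is always [None]. *)
Definition word e : seq letter := [seq code e (inord i) | i <- iota 1 m].

Lemma size_word e : size (word e) = m.
Proof. by rewrite size_map size_iota. Qed.

Lemma nth_word e x :
  e \in @monotone_idem0 m -> nth None (None :: word e) x = code e x.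
Proof.
case/monotone_idem0P=> _ e0 _; case: x => -[|i] im /=.
  by rewrite (_ : Ordinal im = ord0) /code ?e0 ?eqxx //; apply/val_inj.
rewrite (nth_map 0) ?size_iota // nth_iota // add1n.
by congr code; apply/val_inj; rewrite /= inordK.
Qed.

Lemma word_inj : {in @monotone_idem0 m &, injective word}.
Proof.
move=> e e' eE eE' ww; apply: code_inj => // x.
by rewrite -!nth_word // ww.
Qed.

Lemma valid_wordP s : size s = m ->
  reflect ((forall i, i < m ->
              compatible (nth None (None :: s) i) (nth None (None :: s) i.+1)) /\
           nth None (None :: s) m != up)
          (valid_word None s).
Proof.
move=> sm; rewrite /valid_word (last_nth None) sm.
apply: (iffP andP) => -[+ ->] => [/(pathP None)|] sc; split=> //.
  by rewrite sm in sc.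
by apply/(pathP None); rewrite sm.
Qed.

Lemma word_in_words e : e \in @monotone_idem0 m -> word e \in words m.
Proof.
move=> eE; rewrite mem_filter mem_all_words size_word eqxx andbT.
apply/valid_wordP; first exact: size_word.
split=> [i im|].
  have im1 : i < m.+1 by apply: ltnW.
  rewrite (nth_word (Ordinal im1) eE) (nth_word (Ordinal (im : i.+1 < m.+1)) eE).
  exact: code_compatible.
by rewrite (nth_word ord_max eE) code_up -leqNgt -ltnS ltn_ord.
Qed.

Lemma word_surj s : s \in words m -> exists2 e, e \in @monotone_idem0 m & word e = s.
Proof.
rewrite mem_filter mem_all_words => /andP[/[swap]/eqP sm /(valid_wordP sm)[sc sm']].
have [//|e eE ce] := code_surj (W := nth None (None :: s)) _ sc sm'.
exists e => //; apply: (@eq_from_nth _ None); rewrite size_word // => i im.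
by have := nth_word (Ordinal (im : i.+1 < m.+1)) eE; rewrite ce.
Qed.

Lemma card_monotone_idem0 :
  ([set` @monotone_idem0 m] #= `I_(fib (2 * m).+1))%card.
Proof.
(* Idempotents are numbered by the position of their word in the duplicate-free list [words m]. *)
pose f e := index (word e) (words m).
have finj : {in [set` @monotone_idem0 m]%classic &, injective f}.
  move=> e e'; rewrite !inE /= => eE eE' ff; apply: word_inj => //.
  by rewrite -(nth_index [::] (word_in_words eE)) -/(f e) ff nth_index ?word_in_words.
rewrite -(card_eql (inj_card_eq finj)) -size_words.
rewrite (_ : [set f x | x in _]%classic = `I_(size (words m))) ?card_eqxx //.
apply/seteqP; split=> [_ [e eE <-] | i /= im].
  by rewrite /= index_mem word_in_words.
have [e eE we] := word_surj (mem_nth [::] im).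
by exists e; rewrite // /f we index_uniq // filter_uniq // uniq_all_words.
Qed.

End Coding.

Theorem mainTheorem13 (n : nat) (hn : (1 <= n)%N) :
  (idempotents (dominion (@catalan n)) #= `I_(fib (2 * n - 1)))%card.
Proof.
case: n hn => // m _; rewrite idempotents_dominion_catalan mulnS add2n subn1.
exact: card_monotone_idem0.
Qed.
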